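(* Let $L$ be a principally generated C-lattice. The following statements are equivalent. (1) $L$ is a ZPI-lattice. (2) $L$ is a Prüfer lattice and an OAFL. (3) $L$ is a Prüfer lattice and a POAFL.
   Context: A multiplicative lattice is a set $L$ with a commutative associative multiplication and a partial order $\leq$ such that $(L,\leq)$ is a complete lattice with greatest element $1$ and least element $0$, and such that $1x=x$ and $x(\bigvee E)=\bigvee\{xe\mid e\in E\}$ for all $x\in L$ and $E\subseteq L$. An element $a\in L$ is compact if for each $F\subseteq L$ with $a\leq\bigvee F$ there is a finite $E\subseteq F$ with $a\leq\bigvee E$. A subset is multiplicatively closed if it contains $1$ and is closed under products. $L$ is a C-lattice if there is a multiplicatively closed subset $C\subseteq L$ of compact elements such that every element of $L$ is a join of elements of $C$. For $a,b\in L$, $(a:b)=\bigvee\{x\in L\mid xb\leq a\}$. An element $e\in L$ is principal if $a\wedge be=((a:e)\wedge b)e$ and $((a\vee be):e)=(a:e)\vee b$ for all $a,b\in L$. $L$ is principally generated if every element of $L$ is a join of principal elements. $L$ is a Prüfer lattice if every compact element of $L$ is principal. An element $a$ is proper if $a<1$. A proper element $p$ is prime if for all $a,b\in L$, $ab\leq p$ implies $a\leq p$ or $b\leq p$. A proper element $x$ of a C-lattice $L$ is an OA-element ($1$-absorbing prime element) if for all $a,b,c\in L\setminus\{1\}$, $abc\leq x$ implies $ab\leq x$ or $c\leq x$. An OAFL (resp. POAFL) is a C-lattice in which every element (resp. every principal element) is a finite product of OA-elements (the element $1$ being the empty product). A ZPI-lattice is a multiplicative lattice in which every element is a finite product of prime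 elements (the element $1$ being the empty product). *)

(* Defs.v *)
From HB Require Import structures.
From mathcomp Require Import all_boot all_order.
From mathcomp Require Import boolp classical_sets cardinality.

Set Implicit Arguments.
Unset Strict Implicit.
Unset Printing Implicit Defensive.

Import Order.TTheory.

Local Open Scope classical_set_scope.
Local Open Scope order_scope.

Declare Scope mult_lattice_scope.
Delimit Scope mult_lattice_scope with ML.

(* The greatest element 1 and the least element 0 are \top and \bot; meets and
   binary joins are those of the underlying bounded lattice. *)

(* The default value \bot of supremum is its value at set0, which is indeed
   the least upper bound of the empty set. *)
Definition bigsup {d : Order.disp_t} {L : tbLatticeType d} (E : set L) : L :=
  supremum \bot E.

HB.mixin Record TBLattice_isMultLattice (d : Order.disp_t) L
    of Order.TBLattice d L := {
  mlmul : L -> L -> L;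
  mlmulA : associative mlmul;
  mlmulC : commutative mlmul;
  mlmul1x : left_id (\top : L) mlmul;
  supremums_nonempty : forall E : set L, supremums E !=set0;
  mlmul_bigsup : forall (x : L) (E : set L),
    mlmul x (bigsup E) = bigsup [set mlmul x e | e in E]
}.

#[short(type="multLatticeType")]
HB.structure Definition MultLattice (d : Order.disp_t) :=
  { L of TBLattice_isMultLattice d L & Order.TBLattice d L }.

HB.instance Definition _ (d : Order.disp_t) (L : multLatticeType d) :=
  Monoid.isComLaw.Build L \top mlmul mlmulA mlmulC mlmul1x.

Notation "x * y" := (mlmul x y) : mult_lattice_scope.
Local Open Scope mult_lattice_scope.

Section MultLatticeDefs.
Context {d : Order.disp_t} {L : multLatticeType d}.
Implicit Types (a b c e p x : L) (C E F : set L).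

Definition compact_elt a : Prop :=
  forall F, a <= bigsup F ->
    exists E, [/\ finite_set E, E `<=` F & a <= bigsup E].

Definition mult_closed C : Prop :=
  C \top /\ (forall x y, C x -> C y -> C (x * y)).

Definition residual a b : L := bigsup [set x | x * b <= a].

Definition principal_elt e : Prop :=
  (forall a b, a `&` (b * e) = (residual a e `&` b) * e) /\
  (forall a b, residual (a `|` (b * e)) e = residual a e `|` b).

Definition proper_elt a : Prop := a < \top.

Definition prime_elt p : Prop :=
  proper_elt p /\ (forall a b, a * b <= p -> a <= p \/ b <= p).

Definition OA_elt x : Prop :=
  proper_elt x /\
  (forall a b c, a != \top -> b != \top -> c != \top ->
    a * b * c <= x -> a * b <= x \/ c <= x).

(* The empty product is \top. *)
Definition finite_product_of (P : set L) x : Prop :=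
  exists s : seq L,
    (forall y, y \in s -> P y) /\ x = \big[mlmul / \top]_(y <- s) y.

End MultLatticeDefs.

Section MultLatticeClasses.
Context {d : Order.disp_t} (L : multLatticeType d).

Definition C_lattice : Prop :=
  exists C : set L,
    [/\ mult_closed C,
        (forall c, C c -> compact_elt c) &
        (forall x : L, exists E : set L, E `<=` C /\ x = bigsup E)].

Definition principally_generated : Prop :=
  forall x : L, exists E : set L, E `<=` principal_elt /\ x = bigsup E.

Definition Pruefer_lattice : Prop :=
  forall x : L, compact_elt x -> principal_elt x.

Definition OAFL : Prop :=
  C_lattice /\ (forall x : L, finite_product_of OA_elt x).

Definition POAFL : Prop :=
  C_lattice /\ (forall x : L, principal_elt x -> finite_product_of OA_elt x).

Definition ZPI_lattice : Prop :=
  forall x : L, finite_product_of prime_elt x.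

End MultLatticeClasses.

(* Main.v *)
(** From ZPI to Pruefer: an element is principal as soon as it is a join of two
    principal elements [a] and [b] with [(a : b)] and [(b : a)] comaximal, so it
    suffices to compare principal elements locally at a maximal [M].  If some
    principal [a <= M] is not below [M * M], then [a `|` b * b] has a single prime
    factor below [M], which forces [b <= a] locally for every principal
    [b <= M]; hence [M] is locally principal, and a principal element is locally
    zero or a power of [M].  If [M = M * M], unique factorization modulo a prime
    shows that no prime lies strictly below [M], and since the zero element is a
    product of primes, [M] is locally zero.  Modularity of [L] is never available.

    From Pruefer and POAFL to ZPI: in a Pruefer lattice an OA-element is prime or,
    when [M] is the only maximal element, the square of [M], so every compact
    element is a product of primes.  This bounds the length of chains of primes,
    makes every prime compact, and then, as in Cohen's theorem, makes every
    element compact, hence a product of primes. *)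
Require Import Defs.
From mathcomp Require Import all_boot all_order.
From mathcomp Require Import boolp classical_sets cardinality.

Set Implicit Arguments.
Unset Strict Implicit.
Unset Printing Implicit Defensive.

Import Order.TTheory.

Local Open Scope classical_set_scope.
Local Open Scope order_scope.
Local Open Scope mult_lattice_scope.

(** * Residuals and principal elements *)

Section Basics.
Context {d : Order.disp_t} {L : multLatticeType d}.
Implicit Types (a b c e m p q r s t w x y z N M P : L) (E F W : set L).

Lemma bigsup_supremums E : supremums E (bigsup E).
Proof.
have [x Ex] := supremums_nonempty E; rewrite /bigsup /supremum.
case: ifPn => [/eqP ->|_]; last by case: xgetP => [y _|/(_ x)].
by split=> // y _; rewrite le0x.
Qed.

Lemma le_bigsup E x : E x -> x <= bigsup E.
Proof. by have [ub _] := bigsup_supremums E; apply: ub. Qed.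

Lemma bigsup_le E x : (forall y, E y -> y <= x) -> bigsup E <= x.
Proof. by have [_ lb] := bigsup_supremums E; apply: lb. Qed.

Lemma mulmDr x a b : x * (a `|` b) = x * a `|` x * b.
Proof.
have join_bigsup u v : u `|` v = bigsup [set u; v] :> L.
  apply: le_anti; rewrite leUx !le_bigsup /=; [|by right|by left].
  by apply: bigsup_le => w [->|->]; rewrite ?leUl ?leUr.
rewrite !join_bigsup mlmul_bigsup; congr bigsup.
by rewrite image_setU !image_set1.
Qed.

Lemma mulmDl x a b : (a `|` b) * x = a * x `|` b * x.
Proof. by rewrite !(mlmulC _ x) mulmDr. Qed.

Lemma mulmx1 x : x * \top = x.
Proof. by rewrite mlmulC mlmul1x. Qed.

Lemma lem_mul2l x a b : a <= b -> x * a <= x * b.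
Proof. by move=> /join_idPl <-; rewrite mulmDr leUr. Qed.

Lemma lem_mul2r x a b : a <= b -> a * x <= b * x.
Proof. by rewrite !(mlmulC _ x); apply: lem_mul2l. Qed.

Lemma lem_mul a b x y : a <= b -> x <= y -> a * x <= b * y.
Proof. by move=> ab xy; rewrite (le_trans (lem_mul2l _ xy)) ?lem_mul2r. Qed.

Lemma lem_mulr x a : x * a <= x.
Proof. by rewrite -{2}[x]mulmx1 lem_mul2l ?lex1. Qed.

Lemma lem_mull x a : a * x <= x.
Proof. by rewrite mlmulC lem_mulr. Qed.

Lemma mulm0 x : x * \bot = \bot.
Proof. by apply/eqP; rewrite -lex0 lem_mull. Qed.

Lemma mulmCA : left_commutative (@mlmul d L).
Proof. by move=> x y z; rewrite !mlmulA (mlmulC x). Qed.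

Lemma mulmAC : right_commutative (@mlmul d L).
Proof. by move=> x y z; rewrite -!mlmulA (mlmulC y). Qed.

Lemma comaximal_mulr x a b :
  x `|` a = \top -> x `|` b = \top -> x `|` a * b = \top.
Proof.
move=> xa xb; apply/eqP; rewrite -le1x -{1}(mlmul1x \top) -{1}xa -xb.
rewrite mulmDl !leUx (le_trans (lem_mulr _ _) (leUl _ _)) /= mulmDr leUx.
by rewrite (le_trans (lem_mull _ _) (leUl _ _)) leUr.
Qed.

(** Distributivity over arbitrary joins puts the join defining the residual back into the set it is
    taken over. *)
Lemma le_residual x a b : (x <= residual a b) = (x * b <= a).
Proof.
apply/idP/idP => [xab|]; last exact: le_bigsup.
apply: le_trans (lem_mul2r b xab) _; rewrite /residual mlmulC mlmul_bigsup.
by apply: bigsup_le => _ [y /= yba <-]; rewrite mlmulC.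
Qed.

Lemma mul_residual a b : residual a b * b <= a.
Proof. by rewrite -le_residual. Qed.

Lemma residual_residual a b c : residual (residual a b) c = residual a (c * b).
Proof.
by apply: le_anti; rewrite !le_residual -mlmulA mlmulA -!le_residual !lexx.
Qed.

Lemma residual_leq_l a b : a <= residual a b.
Proof. by rewrite le_residual lem_mulr. Qed.

Lemma residual_eq_top a b : b <= a -> residual a b = \top.
Proof. by move=> ba; apply/eqP; rewrite -le1x le_residual mlmul1x. Qed.

Lemma principal_meetE e z : principal_elt e -> z <= e -> z = residual z e * e.
Proof.
move=> [/(_ z \top)]; rewrite mlmul1x meetx1 => <- _ ze.
exact/esym/meet_idPl.
Qed.

(** The join identity read through residuation. At [a := \bot] it serves both as a cancellation law
    and as Nakayama's lemma. *)
Lemma le_mul_principal e a b t : principal_elt e ->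
  (t * e <= a `|` b * e) = (t <= residual a e `|` b).
Proof. by move=> [_ <-]; rewrite le_residual. Qed.

Lemma principal_top : principal_elt (\top : L).
Proof.
have resT a : residual a \top = a.
  by apply: le_anti; rewrite residual_leq_l -[residual a _]mulmx1 mul_residual.
by split=> a b; rewrite !resT !mulmx1 // ?resT.
Qed.

Lemma principal_mul e f : principal_elt e -> principal_elt f ->
  principal_elt (e * f).
Proof.
move=> [me je] [mf jf]; split=> a b; rewrite -!residual_residual !mlmulA.
  by rewrite mf me.
by rewrite jf je.
Qed.

(* Comaximality of the two residuals makes [a `|` b] agree locally with [a] or
   with [b]; the powers of [r] and [s] are what the localisation costs. *)
Lemma principal_join a b : principal_elt a -> principal_elt b ->
  residual a b `|` residual b a = \top -> principal_elt (a `|` b).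
Proof.
move=> pa pb rs; set c := a `|` b.
have two u v y z : u `|` v = \top -> u * (u * z) <= y -> v * (v * z) <= y -> z <= y.
  move=> uv uz vz.
  have uuv : u * u `|` v * v = \top.
    by apply: comaximal_mulr; rewrite joinC; apply: comaximal_mulr; rewrite joinC.
  by rewrite -(mlmul1x z) -uuv mulmDl leUx -!mlmulA uz vz.
(* One factor [u] passes from [c] to the principal [e], the other from residuals by [e] back to
   residuals by [c]. *)
have loc u e : u * c <= e -> e <= c -> principal_elt e ->
    (forall x y z, z <= x -> z <= y * c -> u * (u * z) <= (residual x c `&` y) * c) /\
    (forall x y z, z * c <= x `|` y * c -> u * (u * z) <= residual x c `|` y).
  move=> uc ec pe; have ures x : u * residual x e <= residual x c.
    rewrite le_residual mulmAC; apply: le_trans (lem_mul2r _ uc) _.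
    by rewrite mlmulC mul_residual.
  split=> x y z.
    move=> zx zy; have : u * z <= x `&` y * e.
      rewrite lexI (le_trans (lem_mull _ _) zx) /=.
      by apply: le_trans (lem_mul2l u zy) _; rewrite mulmCA lem_mul2l.
    rewrite (pe.1 x y) => /(lem_mul2l u)/le_trans; apply.
    rewrite mlmulA lem_mul // lexI.
    rewrite (le_trans (lem_mul2l _ (leIl _ _)) (ures x)) /=.
    exact: le_trans (lem_mull _ _) (leIr _ _).
  move=> zc; have : u * z * e <= x `|` y * e.
    apply: le_trans (lem_mul2l _ ec) _; rewrite -mlmulA.
    apply: le_trans (lem_mul2l u zc) _; rewrite mulmDr leU2 ?lem_mull //.
    by rewrite mulmCA lem_mul2l.
  rewrite le_mul_principal // => /(lem_mul2l u)/le_trans; apply.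
  by rewrite mulmDr leU2 ?lem_mull.
have [ra rb] : residual a b * c <= a /\ residual b a * c <= b.
  by split; rewrite mulmDr leUx ?mul_residual ?lem_mull.
have [ma ja] := loc _ _ ra (leUl _ _) pa.
have [mb jb] := loc _ _ rb (leUr _ _) pb.
split=> x y; apply: le_anti; apply/andP; split.
- by apply: (two _ _ _ _ rs); [apply: ma|apply: mb]; rewrite ?leIl ?leIr.
- rewrite lexI lem_mul2r ?leIr // andbT.
  exact: le_trans (lem_mul2r _ (leIl _ _)) (mul_residual _ _).
- by apply: (two _ _ _ _ rs); [apply: ja|apply: jb]; rewrite mul_residual.
- by rewrite le_residual mulmDl leU2 ?mul_residual.
Qed.

End Basics.

(** * Primes, compactness and maximal elements *)

Definition mprod {d : Order.disp_t} {L : multLatticeType d} (s : seq L) : L :=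
  \big[mlmul / \top]_(y <- s) y.

Definition generating {d : Order.disp_t} {L : multLatticeType d} (G : set L) :=
  forall x : L, exists E : set L, E `<=` G /\ x = bigsup E.

Definition maximal_elt {d : Order.disp_t} {L : multLatticeType d} (m : L) :=
  proper_elt m /\ forall y : L, ~~ (y <= m) -> m `|` y = \top.

Section Primes.
Context {d : Order.disp_t} {L : multLatticeType d}.
Implicit Types (a b c e m p q r x y z N M P : L) (E F W G : set L) (s t : seq L).

Lemma mprod_cat s t : mprod (s ++ t) = mprod s * mprod t.
Proof. exact: big_cat. Qed.

Lemma mprod_cons x s : mprod (x :: s) = x * mprod s.
Proof. exact: big_cons. Qed.

Lemma mprod_nil : mprod ([::] : seq L) = \top.
Proof. exact: big_nil. Qed.

Lemma mprod_rem y s : y \in s -> mprod s = y * mprod (rem y s).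
Proof. by move=> ys; rewrite /mprod (big_rem y). Qed.

Lemma mprod_perm s t : perm_eq s t -> mprod s = mprod t.
Proof. exact: perm_big. Qed.

Lemma mprod_le y s : y \in s -> mprod s <= y.
Proof. by move=> ys; rewrite (mprod_rem ys) lem_mulr. Qed.

Lemma finite_product_mul (A : set L) x y :
  finite_product_of A x -> finite_product_of A y -> finite_product_of A (x * y).
Proof.
move=> [s [sA ->]] [t [tA ->]]; exists (s ++ t); split; last exact/esym/mprod_cat.
by move=> z; rewrite mem_cat => /orP[/sA|/tA].
Qed.

Lemma finite_product1 (A : set L) x : A x -> finite_product_of A x.
Proof. by exists [:: x]; rewrite big_seq1; split=> // y /[!inE] /eqP ->. Qed.

Lemma sub_finite_product (A B : set L) x : (forall y, A y -> finite_product_of B y) ->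
  finite_product_of A x -> finite_product_of B x.
Proof.
move=> AB [s [+ ->]]; elim: s => [|y s IH] sA.
  by exists [::]; split=> //; rewrite !big_nil.
rewrite -[X in finite_product_of _ X]/(mprod (y :: s)) mprod_cons.
apply: finite_product_mul; first by apply: AB; apply: sA; rewrite mem_head.
by apply: IH => z zs; apply: sA; rewrite inE zs orbT.
Qed.

Lemma prime_le_mul p a b : prime_elt p -> (a * b <= p) = (a <= p) || (b <= p).
Proof.
move=> [_ pp]; apply/idP/orP => [/pp //|[ap|bp]].
  exact: le_trans (lem_mulr _ _) ap.
exact: le_trans (lem_mull _ _) bp.
Qed.

Lemma prime_neq1 p : prime_elt p -> ~~ (\top <= p).
Proof. by move=> [/lt_geF -> _]. Qed.

Lemma prime_top p : prime_elt p -> (\top <= p) = false.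
Proof. by move=> /prime_neq1/negbTE. Qed.

Lemma prime_mprod p s : prime_elt p -> mprod s <= p -> exists2 y, y \in s & y <= p.
Proof.
move=> pp; elim: s => [|y s IH]; first by rewrite mprod_nil prime_top.
rewrite mprod_cons prime_le_mul // => /orP[yp|/IH[z zs zp]].
  by exists y; rewrite ?mem_head.
by exists z; rewrite // inE zs orbT.
Qed.

Lemma maximal_prime m : maximal_elt m -> prime_elt m.
Proof.
move=> [m1 mm]; split=> // a b abm; apply/orP; rewrite -[_ || _]negbK negb_or.
apply/negP => /andP[/mm ma /mm mb].
by move: (lt_geF m1); rewrite -(comaximal_mulr ma mb) leUx lexx abm.
Qed.

Lemma bigsup_seq_cons x s : bigsup [set` x :: s] = x `|` bigsup [set` s].
Proof.
apply: le_anti; rewrite leUx; apply/and3P; split.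
- apply: bigsup_le => y /=; rewrite inE => /orP[/eqP ->|ys]; first by rewrite leUl.
  by apply: le_trans (leUr _ _); apply: le_bigsup.
- by apply: le_bigsup; rewrite /= mem_head.
- by apply: bigsup_le => y /= ys; apply: le_bigsup; rewrite /= inE ys orbT.
Qed.

Lemma bigsup_nil : bigsup [set` [::]] = \bot :> L.
Proof. by apply/eqP; rewrite -lex0; apply: bigsup_le. Qed.

Lemma generating_witness G x y : generating G -> ~~ (x <= y) ->
  exists c, [/\ G c, c <= x & ~~ (c <= y)].
Proof.
move=> /(_ x)[E [EG ->]]; apply: contraNP => noc.
apply: bigsup_le => e Ee; apply: contrapT => /negP ey.
by apply: noc; exists e; split; [apply: EG|apply: le_bigsup|].
Qed.

Lemma generating_le G x y : generating G ->
  (forall c, G c -> c <= x -> c <= y) -> x <= y.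
Proof.
move=> gG xy; apply: contrapT => /negP /(generating_witness gG)[c [Gc cx]].
by rewrite xy.
Qed.

Lemma generating_bigsup G x : generating G -> x = bigsup [set c | G c /\ c <= x].
Proof.
move=> gG; apply: le_anti; rewrite bigsup_le ?andbT; last by move=> c [].
by apply: (generating_le gG) => c Gc cx; apply: le_bigsup.
Qed.

Lemma compact_directed x E y0 : compact_elt x -> E y0 ->
  (forall y z, E y -> E z -> exists2 w, E w & y `|` z <= w) ->
  x <= bigsup E -> exists2 y, E y & x <= y.
Proof.
move=> cx Ey0 dirE /cx[F [/finite_seqP[s ->] sE xF]].
suff [w Ew sw] : exists2 w, E w & bigsup [set` s] <= w.
  by exists w => //; apply: le_trans sw.
elim: s sE {xF} => [|y s IH] sE; first by exists y0; rewrite // bigsup_nil.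
have [z zs|w Ew sw] := IH; first by apply: sE; rewrite /= inE zs orbT.
have Ey : E y by apply: sE; rewrite /= mem_head.
have [v Ev wv] := dirE _ _ Ey Ew; exists v => //.
by apply: le_trans wv; rewrite bigsup_seq_cons leU2.
Qed.

Lemma compact_join a b : compact_elt a -> compact_elt b -> compact_elt (a `|` b).
Proof.
move=> ca cb F; rewrite leUx => /andP[/ca[A [fA AF aA]] /cb[B [fB BF bB]]].
exists (A `|` B)%classic; split=> [|x [/AF|/BF] //|]; first by rewrite finite_setU.
rewrite leUx; apply/andP; split.
  by apply: le_trans aA _; apply: bigsup_le => x Ax; apply: le_bigsup; left.
by apply: le_trans bB _; apply: bigsup_le => x Bx; apply: le_bigsup; right.
Qed.

Lemma compact_bot : compact_elt (\bot : L).
Proof. by move=> F _; exists set0; split=> //; rewrite le0x. Qed.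

Lemma compact_generated_ind G (A : set L) x : generating G ->
  (forall c, G c -> A c) -> A \bot -> (forall a b, A a -> A b -> A (a `|` b)) ->
  compact_elt x -> A x.
Proof.
move=> gG GA A0 AU cx; have [E [EG xE]] := gG x.
have [|F [/finite_seqP[s ->] sE xs]] := cx E; first by rewrite xE.
have -> : x = bigsup [set` s].
  apply: le_anti; rewrite xs /= xE; apply: bigsup_le => y ys.
  by apply: le_bigsup; apply: sE.
elim: s sE {xs} => [|y s IH] sE; first by rewrite bigsup_nil.
rewrite bigsup_seq_cons; apply: AU; first by apply/GA/EG/sE; rewrite /= mem_head.
by apply: IH => z zs; apply: sE; rewrite /= inE zs orbT.
Qed.

(** Zorn's lemma among the members of [A] above [x]; the empty chain is bounded by [x], so [chainA]
    concerns nonempty chains only. *)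
Lemma exists_maximal (A : set L) x : A x ->
  (forall E y0, E y0 -> E `<=` A -> total_on E (fun y z => y <= z) -> A (bigsup E)) ->
  exists m, [/\ A m, x <= m & forall y, A y -> m <= y -> y = m].
Proof.
move=> Ax chainA; pose T := {y : L | A y /\ x <= y}.
pose x0 : T := exist _ x (conj Ax (lexx x)).
have [||C totC|[m [Am xm]] mmax] := @ZL_preorder T x0 (fun u v : T => sval u <= sval v).
- by move=> y; apply: lexx.
- by move=> u v w; apply: le_trans.
- have [[c Cc]|C0] := pselect (exists u, C u); last first.
    by exists x0 => y Cy; case: C0; exists y.
  have AE : A (bigsup [set sval u | u in C]).
    apply: (chainA _ (sval c)); first by exists c.
      by move=> _ [y _ <-]; case: (svalP y).
    by move=> _ _ [y Cy <-] [z Cz <-]; apply: totC.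
  have xE : x <= bigsup [set sval u | u in C].
    apply: le_trans (proj2 (svalP c)) _; apply: le_bigsup; by exists c.
  exists (exist (fun y => A y /\ x <= y) _ (conj AE xE)) => y Cy /=.
  by apply: le_bigsup; exists y.
exists m; split=> // y Ay my.
have xy : x <= y by exact: le_trans my.
by apply: le_anti; rewrite my andbT; apply: (mmax (exist _ y (conj Ay xy)) my).
Qed.

Lemma maximal_above x : compact_elt (\top : L) -> x != \top ->
  exists2 m, maximal_elt m & x <= m.
Proof.
move=> c1 x1; have [||m [m1 xm mmax]] := exists_maximal (A := [set y | y != \top]) (x := x).
- by [].
- move=> E y0 Ey0 EA totE /=; apply/negP => /eqP E1.
  have [||y Ey] := compact_directed c1 Ey0 _ (_ : \top <= bigsup E).
  + move=> y z Ey Ez; have [yz|zy] := totE _ _ Ey Ez.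
      by exists z; rewrite ?leUx ?yz ?lexx.
    by exists y; rewrite ?leUx ?zy ?lexx.
  + by rewrite E1.
  by rewrite le1x; apply/negP; apply: EA.
exists m => //; split; first by rewrite /proper_elt lt_neqAle m1 lex1.
move=> y ym; apply/eqP; apply: contraNT ym => my1.
by rewrite -(mmax _ my1 (leUl _ _)) leUr.
Qed.

Lemma comaximal_of_maximal x y : compact_elt (\top : L) ->
  (forall m, maximal_elt m -> x <= m -> ~~ (y <= m)) -> x `|` y = \top.
Proof.
move=> c1 xy; apply/eqP; apply: contrapT => /negP /(maximal_above c1)[m mm].
by rewrite leUx => /andP[/(xy _ mm)/negP].
Qed.

Lemma comaximal_mprod x s : (forall y, y \in s -> x `|` y = \top) ->
  x `|` mprod s = \top.
Proof.
elim: s => [|y s IH] xs; first by rewrite mprod_nil joinx1.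
rewrite mprod_cons; apply: comaximal_mulr; first by rewrite xs ?mem_head.
by apply: IH => z zs; rewrite xs // inE zs orbT.
Qed.

Lemma C_lattice_top : C_lattice L -> compact_elt (\top : L).
Proof. by move=> [C [[C1 _] /(_ _ C1)]]. Qed.

Lemma C_lattice_generating : C_lattice L -> generating (@compact_elt d L).
Proof.
move=> [C [_ cC gC]] x; have [E [EC ->]] := gC x.
by exists E; split=> // y /EC/cC.
Qed.

(** Closure under products is given on [C]; it spreads because compact elements are finite joins
    from [C] and products distribute over joins. *)
Lemma C_lattice_compact_mul a b : C_lattice L ->
  compact_elt a -> compact_elt b -> compact_elt (a * b).
Proof.
move=> [C [[_ CM] cC gC]] ca cb.
apply: (compact_generated_ind (A := [set y | compact_elt (a * y)]) gC _ _ _ cb)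
  => [c Cc||x y cx cy] /=; last 2 first.
- by rewrite mulm0; apply: compact_bot.
- by rewrite mulmDr; apply: compact_join.
apply: (compact_generated_ind (A := [set x | compact_elt (x * c)]) gC _ _ _ ca)
  => [x Cx||x y cx cy] /=.
- by apply: cC; apply: CM.
- by rewrite mlmulC mulm0; apply: compact_bot.
- by rewrite mulmDl; apply: compact_join.
Qed.

(* If [N] is locally below the multiples of [x] at [m], then [N] is locally
   [N * x], and a principal multiple of [N] vanishes locally by Nakayama. *)
Lemma principal_locally_zero m N x y z W : prime_elt m -> prime_elt N ->
  principal_elt x -> x <= m -> ~~ (x <= N) ->
  N = bigsup W -> (forall w, W w -> ~~ (residual x w <= m)) ->
  principal_elt z -> z = N * y -> ~~ (residual \bot z <= m).
Proof.
move=> pm pN px xm xN NW Wx pz zNy; apply/negP => zm.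
(* [z] is the join of the [w * y], and each of these is a multiple of [z]; cancelling [z] leaves
   some [residual (w * y) z] outside [m]. *)
pose F := [set residual (w * y) z | w in W].
have zF : \top <= residual \bot z `|` bigsup F.
  rewrite -le_mul_principal // mlmul1x join0x.
  rewrite mlmulC mlmul_bigsup {1}zNy NW mlmulC mlmul_bigsup.
  apply: bigsup_le => _ [w Ww <-].
  have wyz : y * w <= z by rewrite zNy NW mlmulC lem_mul2r ?le_bigsup.
  rewrite (principal_meetE pz wyz) (mlmulC y) mlmulC; apply: le_bigsup.
  by exists (residual (w * y) z) => //; exists w.
have [w Ww wm] : exists2 w, W w & ~~ (residual (w * y) z <= m).
  apply: contrapT => noW; move: (prime_neq1 pm); rewrite (le_trans zF) //.
  rewrite leUx zm; apply: bigsup_le => _ [w Ww <-]; apply: contrapT => /negP wm.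
  by apply: noW; exists w.
set t := residual (w * y) z in wm *; set s := residual x w.
(* [s * w] is a multiple of [x] below the prime [N], and [x] is not below [N], so the cofactor
   is. *)
have swNx : s * w <= N * x.
  rewrite (principal_meetE px (mul_residual x w)) lem_mul2r //.
  have : residual (s * w) x * x <= N.
    apply: le_trans (mul_residual _ _) _; apply: le_trans (lem_mull _ _) _.
    by rewrite NW le_bigsup.
  by rewrite prime_le_mul // (negbTE xN) orbF.
have : s * t * z <= \bot `|` x * z.
  rewrite join0x -mlmulA.
  apply: le_trans (lem_mul2l s (mul_residual (w * y) z)) _.
  by rewrite mlmulA zNy mlmulA (mlmulC x) lem_mul2r.
rewrite le_mul_principal // => st.
have : s * t <= m by apply: le_trans st _; rewrite leUx zm.
by rewrite prime_le_mul // (negbTE (Wx _ Ww)) (negbTE wm).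
Qed.

End Primes.

(** * From ZPI to Pruefer *)

Definition mpow {d : Order.disp_t} {L : multLatticeType d} (x : L) k : L :=
  iter k (mlmul x) \top.

(** Cancellation by [J] in the quotient lattice of elements above [P], without forming it. *)
Definition cancellable_mod {d : Order.disp_t} {L : multLatticeType d} (P J : L) :=
  forall x y : L, J * x <= J * y `|` P -> x <= y `|` P.

(** * Powers and unique factorization modulo a prime *)

Section UniqueFactorization.
Context {d : Order.disp_t} {L : multLatticeType d}.
Implicit Types (a b c e m p q r u v x y z J N M P : L) (s t : seq L).

Lemma mpowD x k j : mpow x (k + j) = mpow x k * mpow x j.
Proof.
elim: k => [|k IH]; first by rewrite mlmul1x.
by rewrite addSn /mpow !iterS -mlmulA -IH.
Qed.

Lemma mpow_le x k j : (k <= j)%N -> mpow x j <= mpow x k.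
Proof. by move=> /subnKC <-; rewrite mpowD lem_mulr. Qed.

Lemma mpow_idempotent x k : x * x = x -> mpow x k.+1 = x.
Proof.
move=> xx; elim: k => [|k IH]; first exact: mulmx1.
by rewrite /mpow iterS -/(mpow x k.+1) IH.
Qed.

Lemma principal_mpow x k : principal_elt x -> principal_elt (mpow x k).
Proof.
move=> px; elim: k => [|k IH]; first exact: principal_top.
by rewrite /mpow iterS; apply: principal_mul.
Qed.

Lemma prime_mpow p x k : prime_elt p -> ~~ (x <= p) -> ~~ (mpow x k <= p).
Proof.
move=> pp xp; elim: k => [|k IH]; first exact: prime_neq1.
by rewrite /mpow iterS prime_le_mul // negb_or xp.
Qed.

Lemma residual_prime P c : prime_elt P -> ~~ (c <= P) -> residual P c = P.
Proof.
move=> pP cP; apply: le_anti; rewrite residual_leq_l andbT.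
by have := mul_residual P c; rewrite prime_le_mul // (negbTE cP) orbF.
Qed.

Lemma cancellable_mod_principal P c : prime_elt P -> principal_elt c ->
  ~~ (c <= P) -> cancellable_mod P c.
Proof.
move=> pP pc cP x y; rewrite joinC -!(mlmulC _ c) le_mul_principal //.
by rewrite residual_prime // joinC.
Qed.

Lemma cancellable_mod_mul P a b :
  cancellable_mod P a -> cancellable_mod P b -> cancellable_mod P (a * b).
Proof.
move=> ca cb x y; rewrite -!mlmulA => /ca; exact: cb.
Qed.

Lemma cancellable_mod_join P a : cancellable_mod P a -> cancellable_mod P (a `|` P).
Proof.
move=> ca x y xy; apply: ca; apply: le_trans (lem_mul2r _ (leUl _ P)) _.
apply: le_trans xy _; rewrite mulmDl -joinA leU2 // leUx lexx andbT.
exact: lem_mulr.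
Qed.

Lemma mul_congr_mod P a b x y : a `|` P = b `|` P -> x `|` P = y `|` P ->
  a * x `|` P = b * y `|` P.
Proof.
suff le u v z w : u `|` P = v `|` P -> z `|` P = w `|` P -> u * z `|` P <= v * w `|` P.
  by move=> ab xy; apply: le_anti; rewrite !le.
move=> uv zw; rewrite leUx leUr andbT.
apply: (@le_trans _ _ ((v `|` P) * (w `|` P))).
  by rewrite -uv -zw lem_mul ?leUl.
by rewrite mulmDl !mulmDr !leUx leUl !(le_trans _ (leUr P _)) ?lem_mulr ?lem_mull.
Qed.

Lemma exists_minimal_mem s x : x \in s ->
  exists2 y, y \in s & forall z, z \in s -> z <= y -> z = y.
Proof.
elim: s x => [//|y [_ x _|w s IH x _]].
  by exists y; rewrite ?mem_head // => z /[!inE] /eqP ->.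
have [N Ns Nmin] := IH w (mem_head w s).
have [yN|yN] := boolP (y <= N); last first.
  exists N => [|z]; rewrite inE ?Ns ?orbT // => /orP[/eqP ->|/Nmin //].
  by rewrite (negbTE yN).
exists y => [|z]; rewrite inE ?eqxx // => /orP[/eqP //|zs] zy.
have zN := Nmin _ zs (le_trans zy yN).
by apply: le_anti; rewrite zy zN yN.
Qed.

(** A minimal prime factor [N] on the left lies above a factor [C] on the right, which lies above a
    factor on the left, so [C = N] by minimality. Factors inherit cancellability, so [N] can be
    cancelled. *)
Lemma prime_factors_unique P s t :
  (forall y, y \in s -> prime_elt y /\ P <= y) ->
  (forall y, y \in t -> prime_elt y /\ P <= y) ->
  cancellable_mod P (mprod s) -> mprod s `|` P = mprod t `|` P -> perm_eq s t.
Proof.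
have [n] := ubnP (size s); elim: n s t => // n IH s t sn pS pT cS st.
case: (s =P [::]) => [s0|/eqP s0].
  case: t pT st => [_ _|y t pT st]; first by rewrite s0.
  have [py Py] := pT y (mem_head y t); have := prime_neq1 py.
  rewrite (@le_trans _ _ (mprod s `|` P)) //; first by rewrite s0 mprod_nil leUl.
  by rewrite st leUx Py mprod_le ?mem_head.
have [x xs] : exists x, x \in s.
  by case: (s) s0 => [//|x s' _]; exists x; rewrite mem_head.
have [N Ns Nmin] := exists_minimal_mem xs; have [pN PN] := pS _ Ns.
have /(prime_mprod pN)[C Ct CN] : mprod t <= N.
  by apply: le_trans (leUl _ P) _; rewrite -st leUx PN mprod_le.
have [pC PC] := pT _ Ct.
have /(prime_mprod pC)[N' N's N'C] : mprod s <= C.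
  by apply: le_trans (leUl _ P) _; rewrite st leUx PC mprod_le.
have N'N := Nmin _ N's (le_trans N'C CN).
have {N'N N's} Nt : N \in t.
  by rewrite (_ : N = C) //; apply: le_anti; rewrite CN -{1}N'N N'C.
have sE := mprod_rem Ns; have tE := mprod_rem Nt.
have cN : cancellable_mod P N.
  move=> u v uv; apply: cS; rewrite sE -!mlmulA !(mulmCA N).
  apply: le_trans (lem_mul2l _ uv) _.
  by rewrite mulmDr leU2 // lem_mull.
rewrite (perm_trans (perm_to_rem Ns)) // perm_sym (perm_trans (perm_to_rem Nt)) //.
rewrite perm_cons perm_sym; apply: IH.
- by move: sn; rewrite (perm_size (perm_to_rem Ns)).
- by move=> y /mem_rem/pS.
- by move=> y /mem_rem/pT.
- move=> u v uv; apply: cS; rewrite sE -!mlmulA.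
  apply: le_trans (lem_mul2l N uv) _; rewrite mulmDr leU2 //.
  exact: lem_mull.
- apply: le_anti; rewrite !leUx !leUr !andbT; apply/andP; split; apply: cN.
    by rewrite -sE -tE -st leUl.
  by rewrite -sE -tE st leUl.
Qed.

End UniqueFactorization.

(** * Local structure of principal elements in a ZPI-lattice *)

Section ZPI.
Context {d : Order.disp_t} (L : multLatticeType d).
Hypotheses (zpi : ZPI_lattice L) (pgen : generating (@principal_elt d L)).
Implicit Types (a b c e m p q r u v x y z J N M P : L) (s t l : seq L).

Lemma prime_factors_above P x : exists2 s,
  (forall y, y \in s -> prime_elt y /\ P <= y) & mprod s = x `|` P.
Proof.
have [s [ps xP]] := zpi (x `|` P); exists s => // y ys; split; first exact: ps.
by apply: le_trans (leUr P x) _; rewrite xP; apply: mprod_le.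
Qed.

(** Both sides are products of primes above [N] and agree modulo [N], so they have the same factors.
    The gain is that [N] lies below the square of the join of [c] and [N]. *)
Lemma prime_join_square N c : prime_elt N -> principal_elt c -> ~~ (c <= N) ->
  c * c `|` N = (c `|` N) * (c `|` N).
Proof.
move=> pN pc cN; have [s ps sE] := prime_factors_above N c.
have [t pt tE] := prime_factors_above N (c * c).
have ssE : mprod (s ++ s) = (c `|` N) * (c `|` N) by rewrite mprod_cat sE.
rewrite -tE -ssE; apply/esym/mprod_perm/(@prime_factors_unique _ _ N) => //.
- by move=> y; rewrite mem_cat orbb; apply: ps.
- rewrite ssE.
  by apply: cancellable_mod_mul; apply/cancellable_mod_join/cancellable_mod_principal.
- rewrite tE ssE -joinA joinxx.
  by apply: mul_congr_mod; rewrite -joinA joinxx.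
Qed.

Lemma mprod_primes_above M l : prime_elt M ->
  (forall y, y \in l -> y <= M -> y = M) ->
  exists k (s : L), ~~ (s <= M) /\ mprod l = mpow M k * s.
Proof.
move=> pM; elim: l => [|y l IH] lM.
  by exists 0, \top; rewrite prime_neq1 // mprod_nil mlmul1x.
have [|k [s [sM lE]]] := IH; first by move=> z zl; apply: lM; rewrite inE zl orbT.
rewrite mprod_cons lE; have [yM|yM] := boolP (y <= M).
  by exists k.+1, s; rewrite {1}(lM y) ?mem_head // mlmulA.
by exists k, (y * s); rewrite prime_le_mul // negb_or yM mulmCA.
Qed.

(** Each of the [k] copies of a factorization of the join of [c] and [P] contributes a prime below
    [M]. *)
Lemma mpow_factors P M c k : c <= M -> P <= M -> prime_elt M ->
  exists s, [/\ forall y, y \in s -> prime_elt y /\ P <= y,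
    mprod s `|` P = mpow c k `|` P & (k <= count (fun y : L => (y <= M)%O) s)%N].
Proof.
move=> cM PM pM; elim: k => [|k [t [pt tE kt]]]; first by exists [::]; rewrite mprod_nil.
have [s ps sE] := prime_factors_above P c; exists (s ++ t); split.
- by move=> y; rewrite mem_cat => /orP[/ps|/pt].
- by rewrite mprod_cat /mpow iterS; apply: mul_congr_mod; rewrite // sE -joinA joinxx.
rewrite count_cat -addn1 addnC leq_add // -has_count; apply/hasP.
by have [|y ys yM] := @prime_mprod _ _ M s pM; [rewrite sE leUx cM PM|exists y].
Qed.

(* If [a] is a principal element below [M] but not below [P], and [N < M] is a
   prime factor of [a], then every power of every principal [c] with
   [c <= M], [~ c <= N] divides [a] locally at [M], which contradicts unique
   factorization modulo [P]; and if all prime factors of [a] below [M] are [M],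
   then [a = M * a] vanishes locally. *)
Lemma idempotent_prime_minimal M P : prime_elt M -> M * M = M ->
  prime_elt P -> P <= M -> M <= P.
Proof.
move=> pM MM pP PM; apply: contrapT => /negP /(generating_witness pgen)[a [pa aM aP]].
have [l [pl aE]] := zpi a.
have [[N [Nl NM NneM]]|noN] :=
  pselect (exists N, [/\ N \in l, N <= M & N != M]); last first.
  have [|k [s [sM lE]]] := @mprod_primes_above M l pM.
    by move=> y yl yM; apply: contrapT => /eqP yneM; apply: noN; exists y.
  case: k lE => [|k]; first by rewrite mlmul1x -[mprod l]aE => as_; rewrite -as_ aM in sM.
  rewrite mpow_idempotent // -[mprod l]aE => aMs.
  have : \top * a <= \bot `|` M * a by rewrite join0x mlmul1x aMs mlmulA MM.
  rewrite le_mul_principal // => top_le; have := prime_neq1 pM.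
  rewrite (le_trans top_le) // leUx lexx andbT.
  have : residual \bot a * a <= P by rewrite (le_trans (mul_residual _ _)) ?le0x.
  by rewrite prime_le_mul // (negbTE aP) orbF => /le_trans; apply.
have pN := pl _ Nl.
have [c [pc cM cN]] : exists c, [/\ principal_elt c, c <= M & ~~ (c <= N)].
  apply: generating_witness => //; apply: contra NneM => MN.
  by apply/eqP/le_anti; rewrite NM MN.
have [sa psa saE] := prime_factors_above P a.
(* One more than the number of factors of [a] modulo [P] that lie below [M]. *)
pose k := (count (fun y : L => (y <= M)%O) sa).+1; pose cc := mpow c k.
have pcc : principal_elt cc by apply: principal_mpow.
have ccN : ~~ (cc <= N) by apply: prime_mpow.
have ccM : cc <= M by apply: le_trans cM; rewrite /cc /mpow iterS lem_mulr.
pose R := mprod (rem N l).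
have aNR : a = N * R by rewrite aE; apply: mprod_rem.
(* As [a = N * R], bounding [N] by the square of the join of [cc] and [N] turns every term except
   [cc * cc * R] into a multiple of [a] by [cc] or [N], both below [M]. *)
have aR : \top * a <= cc * cc * R `|` (cc `|` N) * a.
  rewrite mlmul1x {1}aNR; apply: le_trans (lem_mul2r _ (leUr _ (cc * cc))) _.
  rewrite prime_join_square // -mlmulA mulmDl !(mulmDl, mulmDr) !leUx.
  have NccR : N * (cc * R) = cc * a by rewrite mulmCA aNR.
  rewrite NccR -aNR mlmulA leUl (le_trans (leUl (cc * a) (N * a)) (leUr _ _)).
  exact: le_trans (leUr _ (cc * a)) (leUr _ _).
have resM : ~~ (residual (cc * cc * R) a <= M).
  apply/negP => resM; move: aR; rewrite le_mul_principal // => top_le.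
  have := prime_neq1 pM; rewrite (le_trans top_le) //.
  by rewrite !leUx resM ccM.
have [v [pv va vM]] := generating_witness pgen resM.
have vacc : v * a <= cc.
  move: va; rewrite le_residual => /le_trans; apply.
  by rewrite -mlmulA lem_mulr.
have vaE := principal_meetE pcc vacc.
have [sv psv svE] := prime_factors_above P v.
have [su psu suE] := prime_factors_above P (residual (v * a) cc).
have [sc [psc scE ksc]] := @mpow_factors P M c k cM PM pM.
have vP : ~~ (v <= P) by apply: contra vM => /le_trans; apply.
(* Counting factors below [M] on both sides of [v * a = residual (v * a) cc * cc] modulo [P]: [v]
   has none, [a] has [k - 1], [cc] at least [k]. *)
have /permP/(_ (fun y : L => (y <= M)%O)) : perm_eq (sv ++ sa) (su ++ sc).
  apply: (@prime_factors_unique _ _ P).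
  - by move=> y; rewrite mem_cat => /orP[/psv|/psa].
  - by move=> y; rewrite mem_cat => /orP[/psu|/psc].
  - by rewrite mprod_cat svE saE; apply: cancellable_mod_mul;
      apply/cancellable_mod_join/cancellable_mod_principal.
  - rewrite !mprod_cat svE saE suE.
    transitivity (v * a `|` P); first by apply: mul_congr_mod; rewrite -joinA joinxx.
    rewrite {1}vaE; apply/esym/mul_congr_mod; last exact: scE.
    by rewrite -joinA joinxx.
rewrite !count_cat (_ : count _ sv = 0%N); last first.
  apply/eqP; rewrite -leqn0 leqNgt -has_count; apply/hasPn => y yv.
  apply: contra vM; apply: le_trans; apply: le_trans (leUl v P) _.
  by rewrite -svE mprod_le.
rewrite add0n => cnt; move: ksc; rewrite leqNgt /k ltnS cnt.
by rewrite leq_addl.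
Qed.

Lemma principal_local_form M b : prime_elt M -> principal_elt b ->
  ~~ (residual \bot b <= M) \/ exists k (s : L), ~~ (s <= M) /\ b = mpow M k * s.
Proof.
move=> pM pb; have [MM|] := boolP (M <= M * M).
  have {}MM : M * M = M by apply: le_anti; rewrite MM lem_mulr.
  have [bM|bM] := boolP (b <= M); last by right; exists 0, b; rewrite mlmul1x.
  (* [\bot] is [\top] or [M] times a cofactor [s] outside [M], and this [s] kills everything below
     [M]. *)
  left; have [l [pl l0]] := zpi \bot.
  have [|k [s [sM lE]]] := @mprod_primes_above M l pM.
    move=> y yl yM; apply: le_anti; rewrite yM.
    by apply: idempotent_prime_minimal => //; apply: pl.
  apply: contra sM; apply: le_trans; rewrite le_residual.
  case: k lE => [|k]; first by rewrite mlmul1x -[mprod l]l0 => <-; rewrite lem_mulr.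
  rewrite mpow_idempotent // -[mprod l]l0 => ->; rewrite mlmulC lem_mul2r //.
move=> /(generating_witness pgen)[a [pa aM aMM]].
(* Only one prime factor of the join of [a] and [w * w] is below [M], since two would put [a] below
   [M * M]. That factor lies above [w], so the cofactor [s] carries [w] into the join, and [w]
   cancels. *)
have aloc w : principal_elt w -> w <= M -> ~~ (residual a w <= M).
  move=> pw wM; have [l [pl xE]] := zpi (a `|` w * w).
  have [N Nl NM] : exists2 y, y \in l & y <= M.
    by apply: (prime_mprod pM); rewrite -[mprod l]xE leUx aM (le_trans (lem_mulr _ _)).
  have {}xE : a `|` w * w = N * mprod (rem N l) by rewrite xE; apply: mprod_rem.
  set s := mprod _ in xE.
  have wN : w <= N.
    have : w * w <= N by apply: le_trans (leUr _ a) _; rewrite xE lem_mulr.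
    by rewrite prime_le_mul ?orbb //; apply: pl.
  have sM : ~~ (s <= M).
    apply: contra aMM => sM; apply: le_trans (leUl _ (w * w)) _.
    by rewrite xE lem_mul.
  have : s * w <= a `|` w * w by rewrite xE (mlmulC N) lem_mul2l.
  rewrite le_mul_principal // => sw; apply: contra sM => resM.
  by apply: le_trans sw _; rewrite leUx resM.
have [l [pl bE]] := zpi b.
case: (pselect (exists N, [/\ N \in l, N <= M & N != M])) => [[N [Nl NM NneM]]|noN].
  left; have pN := pl _ Nl.
  have aN : ~~ (a <= N).
    apply: contra NneM => aN; apply/eqP/le_anti; rewrite NM.
    apply: (generating_le pgen) => w pw wM.
    have : residual a w * w <= N by apply: le_trans (mul_residual _ _) aN.
    rewrite prime_le_mul // => /orP[resN|//].
    by move: (aloc _ pw wM); rewrite (le_trans resN).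
  apply: (@principal_locally_zero _ _ M N a (mprod (rem N l)) b
           [set w | principal_elt w /\ w <= N]) => //.
  - exact: generating_bigsup.
  - by move=> w [pw wN]; apply: aloc => //; apply: le_trans NM.
  - by rewrite bE; apply: mprod_rem.
right; rewrite bE; apply: mprod_primes_above => // y yl yM.
by apply: contrapT => /eqP yneM; apply: noN; exists y.
Qed.

(** Locally both elements are zero or powers of [M], and these are linearly ordered. *)
Lemma principal_locally_comparable M a b : prime_elt M ->
  principal_elt a -> principal_elt b -> residual a b <= M -> ~~ (residual b a <= M).
Proof.
have mono x y z : x <= residual \bot y -> x <= residual z y.
  by rewrite !le_residual => /le_trans; apply; rewrite le0x.
move=> pM pa pb abM; have [a0|[k [s [sM aE]]]] := principal_local_form pM pa.
  by apply: contra a0; apply: le_trans; apply: mono.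
have [b0|[j [t [tM bE]]]] := principal_local_form pM pb.
  by move: b0; rewrite (le_trans (mono _ _ a (lexx _)) abM).
have div k' j' (s' t' : L) : (k' <= j')%N ->
    s' <= residual (mpow M k' * s') (mpow M j' * t').
  move=> kj; rewrite le_residual (mlmulC _ s') lem_mul2l //.
  by apply: le_trans (lem_mulr _ _) (mpow_le _ kj).
have [kj|/ltnW jk] := leqP k j.
  by move: sM; rewrite (le_trans _ abM) // {1}aE bE div.
by apply: contra tM => /(le_trans _); apply; rewrite {1}bE aE div.
Qed.

(** Compact elements are finite joins of principal ones, and local comparability makes the residuals
    of two principal elements comaximal. *)
Lemma ZPI_Pruefer : compact_elt (\top : L) -> Pruefer_lattice L.
Proof.
move=> c1 x; apply: (compact_generated_ind pgen) => //.
  split=> a b; first by rewrite !mulm0 meetx0.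
  by rewrite mulm0 joinx0 residual_eq_top ?le0x // join1x.
move=> a b pa pb; apply: principal_join => //.
apply: comaximal_of_maximal => // m /maximal_prime pm.
exact: principal_locally_comparable.
Qed.

End ZPI.

(** * From Pruefer and POAFL to ZPI *)

Section Pruefer.
Context {d : Order.disp_t} (L : multLatticeType d).
Hypotheses (LC : C_lattice L) (LP : Pruefer_lattice L).
Implicit Types (a b c e m p q r u v x y z J N M P : L) (s t l : seq L).

Let c1 := C_lattice_top LC.
Let cgen := C_lattice_generating LC.

(** Both [a] and [b] are multiples of their principal join [c]; cancelling [c] makes the two
    cofactors and the annihilator of [c] join to [\top]. *)
Lemma Pruefer_residual_comaximal a b : compact_elt a -> compact_elt b ->
  residual a b `|` residual b a = \top.
Proof.
move=> ca cb; have pc := LP (compact_join ca cb); set c := a `|` b in pc.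
have anti x y : y <= c -> residual x c <= residual x y.
  by move=> yc; rewrite le_residual (le_trans (lem_mul2l _ yc)) ?mul_residual.
have : \top * c <= \bot `|` (residual a c `|` residual b c) * c.
  rewrite mlmul1x join0x mulmDl -(principal_meetE pc (leUl a b)).
  by rewrite -(principal_meetE pc (leUr b a)).
rewrite le_mul_principal // => top_le; apply/eqP; rewrite -le1x.
apply: le_trans top_le _; rewrite !leUx; apply/and3P; split.
- apply: le_trans (leUl _ _); apply: le_trans (anti _ _ (leUr b a)).
  by rewrite le_residual (le_trans (mul_residual _ _)) ?le0x.
- by apply: le_trans (leUl _ _); apply: anti; apply: leUr.
- by apply: le_trans (leUr _ _); apply: anti; apply: leUl.
Qed.

(** Compact [a] and [b] separating the primes have [residual a b <= p] and [residual b a <= q]. *)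
Lemma Pruefer_primes_comaximal p q : prime_elt p -> prime_elt q ->
  ~~ (p <= q) -> ~~ (q <= p) -> p `|` q = \top.
Proof.
move=> pp pq /(generating_witness cgen)[a [ca ap aq]].
move=> /(generating_witness cgen)[b [cb bq bp]].
apply/eqP; rewrite -le1x -(Pruefer_residual_comaximal ca cb) leU2 //.
  have := le_trans (mul_residual a b) ap.
  by rewrite prime_le_mul // (negbTE bp) orbF.
have := le_trans (mul_residual b a) bq.
by rewrite prime_le_mul // (negbTE aq) orbF.
Qed.

(** If [x] is not prime, the absorbing property turns a failure [a * b <= x] into [c * a <= x] for
    all proper [c]. Hence every proper [c] is below [M], and [M * M <= x <= M]; when [M] is not
    idempotent it is principal, which leaves [x = M] or [x = M * M]. *)
Lemma OA_product_of_primes x : OA_elt x -> finite_product_of prime_elt x.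
Proof.
move=> [xprop xOA]; have [px|npx] := pselect (prime_elt x).
  exact: finite_product1.
have [a [b [abx ax bx]]] : exists a b, [/\ a * b <= x, ~~ (a <= x) & ~~ (b <= x)].
  apply: contrapT => noab; apply: npx; split=> // a b abx.
  apply/orP; apply: contrapT; move=> /negP; rewrite negb_or => /andP[ax bx].
  by apply: noab; exists a, b.
have xne : x != \top by rewrite lt_eqF.
have [M mM xM] := maximal_above c1 xne; have pM := maximal_prime mM.
have Mne : M != \top by case: pM => /lt_eqF ->.
have ane : a != \top.
  by apply: contraNneq bx => a1; move: abx; rewrite a1 mlmul1x.
have bne : b != \top.
  by apply: contraNneq ax => b1; move: abx; rewrite b1 mulmx1.
have cax c : c != \top -> c * a <= x.
  move=> cne; have : c * a * b <= x.
    by rewrite -mlmulA (le_trans (lem_mull _ _)).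
  by move=> /(xOA _ _ _ cne ane bne)[//|]; rewrite (negbTE bx).
have leM c : c != \top -> c <= M.
  move=> cne; apply: contraNT ax => /mM.2 Mc.
  by rewrite -(mlmul1x a) -Mc mulmDl leUx !cax.
have MMx : M * M <= x.
  have : M * M * a <= x by rewrite -mlmulA (le_trans (lem_mull _ _)) ?cax.
  by move=> /(xOA _ _ _ Mne Mne ane)[//|]; rewrite (negbTE ax).
have [MM|] := boolP (M <= M * M).
  have -> : x = M by apply: le_anti; rewrite xM (le_trans MM).
  exact: finite_product1.
move=> /(generating_witness cgen)[e [ce eM eMM]]; have pe := LP ce.
(* Since all proper elements are below [M], a compact [b' <= M] not below [e] would divide [e] with
   cofactor below [M], giving [e <= M * M]. *)
have Me : M <= e.
  apply: (generating_le cgen) => b' cb' b'M.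
  apply: contraNT eMM => b'e.
  have ebM : residual e b' <= M.
    by apply: leM; rewrite -le1x le_residual mlmul1x.
  have : ~~ (residual b' e <= M).
    apply/negP => beM; move: (prime_neq1 pM).
    by rewrite -(Pruefer_residual_comaximal ce cb') leUx ebM beM.
  move=> /(contraNeq (leM _)) be1.
  have eb : e <= b' by rewrite -(mlmul1x e) -be1 mul_residual.
  by rewrite (principal_meetE (LP cb') eb) lem_mul.
have eE : e = M by apply: le_anti; rewrite eM Me.
have xE := principal_meetE pe (le_trans xM Me); rewrite eE in xE.
have [r1|/leM rM] := eqVneq (residual x M) \top.
  by rewrite xE r1 mlmul1x; apply: finite_product1.
have -> : x = M * M by apply: le_anti; rewrite MMx andbT {1}xE lem_mul2r.
by apply: finite_product_mul; apply: finite_product1.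
Qed.

(* Cohen's theorem: a maximal non-compact element [p] is prime, since
   [a * b <= p] with [a] and [b] not below [p] would give [p = (p : c) * c] with
   [c := p `|` a] and [(p : c)] both strictly above [p], hence compact. *)
Lemma Pruefer_Cohen : (forall p, prime_elt p -> compact_elt p) ->
  forall x, compact_elt x.
Proof.
move=> cprime x; apply: contrapT => ncx.
have [||p [ncp xp pmax]] := @exists_maximal _ _ [set y | ~ compact_elt y] x.
- by [].
- move=> E y0 Ey0 EA totE cE.
  have [y z Ey Ez|y Ey Ey1] := compact_directed cE Ey0 _ (lexx _).
    have [yz|zy] := totE _ _ Ey Ez; first by exists z; rewrite ?leUx ?yz ?lexx.
    by exists y; rewrite ?leUx ?zy ?lexx.
  have : y = bigsup E by apply: le_anti; rewrite Ey1 le_bigsup.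
  by move=> yE; apply: (EA _ Ey); rewrite yE.
have above y : p <= y -> ~~ (y <= p) -> compact_elt y.
  move=> py yp; apply: contrapT => /pmax/(_ py) ypE.
  by move: yp; rewrite ypE lexx.
apply: (ncp); apply: cprime; split.
  by rewrite /proper_elt lt_neqAle lex1 andbT; apply: contra_not_neq ncp => ->.
move=> a b abp; apply/orP; apply: contrapT => /negP; rewrite negb_or => /andP[ap bp].
have cc : compact_elt (p `|` a) by apply: above; rewrite ?leUl // leUx lexx.
apply: ncp; rewrite (principal_meetE (LP cc) (leUl p a)).
apply: C_lattice_compact_mul => //; apply: above; first exact: residual_leq_l.
apply: contra bp; apply: le_trans; rewrite le_residual mulmDr leUx lem_mull.
by rewrite mlmulC.
Qed.

(** * Compactness of primes when compact elements are products of primes *)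

Section CompactFactorization.
Hypothesis cfac : forall x : L, compact_elt x -> finite_product_of prime_elt x.

(** A compact [x <= m] not below [p] is not below a prime factor [N <= p] of [y] either, so every
    compact element below [N] is a local multiple of [x], and Nakayama applies. *)
Lemma locally_zero_below_prime p m y : prime_elt p -> prime_elt m ->
  p <= m -> ~~ (m <= p) -> compact_elt y -> y <= p -> ~~ (residual \bot y <= m).
Proof.
move=> pp pm pm_le /(generating_witness cgen)[x [cx xm xp]] cy yp.
have [l [pl yE]] := cfac cy.
have [N Nl Np] : exists2 N, N \in l & N <= p.
  by apply: prime_mprod; rewrite // -[mprod l]yE.
apply: (@principal_locally_zero _ _ m N x (mprod (rem N l)) y
          [set w | compact_elt w /\ w <= N]) => //.
- exact: pl.
- exact: LP.
- by apply: contra xp => /le_trans; apply.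
- exact: generating_bigsup.
- move=> w [cw wN]; apply/negP => xw; move: (prime_neq1 pm).
  rewrite -(Pruefer_residual_comaximal cx cw) leUx xw /=.
  have : residual w x * x <= p.
    exact: le_trans (mul_residual _ _) (le_trans wN Np).
  by rewrite prime_le_mul // (negbTE xp) orbF => /le_trans ->.
- exact: LP.
- by rewrite yE; apply: mprod_rem.
Qed.

(** A compact [y <= p] is locally zero at [m], so its annihilator is not below [q], and primeness of
    [q] forces [y <= q]. *)
Lemma prime_chain_length q p m : prime_elt q -> prime_elt p -> prime_elt m ->
  q <= p -> p <= m -> ~~ (m <= p) -> p <= q.
Proof.
move=> pq pp pm qp pm_le mp; apply: (generating_le cgen) => y cy yp.
have : residual \bot y * y <= q by rewrite (le_trans (mul_residual _ _)) ?le0x.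
rewrite prime_le_mul // => /orP[y0|//].
have := locally_zero_below_prime pp pm pm_le mp cy yp.
by rewrite (le_trans y0 (le_trans qp pm_le)).
Qed.

(* Write [\bot = u * r] with [u] the product of the factors above [p] and [r]
   comaximal with [p], hence with some compact [b <= p].  If [p <= y `|` u] with
   [y <= p] compact, then [p * r <= y] and [p = p * b `|` p * r = b `|` y]. *)
Lemma minimal_prime_compact p : prime_elt p ->
  (forall q, prime_elt q -> q <= p -> p <= q) -> compact_elt p.
Proof.
move=> pp pmin; have [l [pl l0]] := cfac (@compact_bot _ L).
pose l1 := [seq y <- l | p <= y]; pose r := mprod [seq y <- l | ~~ (p <= y)].
have ur0 : mprod l1 * r = \bot.
  by rewrite l0 -mprod_cat; apply: mprod_perm; apply/permPl/perm_filterC.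
have pr : p `|` r = \top.
  apply: comaximal_mprod => y; rewrite mem_filter => /andP[py /pl pry].
  by apply: Pruefer_primes_comaximal => //; apply: contra py; apply: pmin.
have [b [cb bp br]] : exists b, [/\ compact_elt b, b <= p & b `|` r = \top].
  have [|||_ [b [cb bp] <-] top_b] := @compact_directed _ _ \top
      [set b `|` r | b in [set b | compact_elt b /\ b <= p]] (\bot `|` r) c1.
  - by exists \bot => //; split; [apply: compact_bot|apply: le0x].
  - move=> _ _ [y [cy yp] <-] [z [cz zp] <-]; exists (y `|` z `|` r).
      by exists (y `|` z); rewrite //= leUx yp; split=> //; apply: compact_join.
    by rewrite joinACA joinxx.
  - rewrite -pr leUx; apply/andP; split.
      apply: (generating_le cgen) => y cy yp.
      by apply: le_trans (leUl y r) _; apply: le_bigsup; exists y.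
    apply: le_trans (leUr r \bot) _; apply: le_bigsup.
    by exists \bot => //; split; [apply: compact_bot|apply: le0x].
  by exists b; split=> //; apply/eqP; rewrite -le1x.
suff [y [cy yp pyu]] : exists y, [/\ compact_elt y, y <= p & p <= y `|` mprod l1].
  suff -> : p = b `|` y by apply: compact_join.
  apply: le_anti; rewrite leUx bp yp andbT -{1}(mulmx1 p) -br mulmDr leU2 ?lem_mull //.
  by apply: le_trans (lem_mul2r r pyu) _; rewrite mulmDl ur0 joinx0 lem_mulr.
(* If a prime lies strictly above [p], each compact [c <= p] is locally zero at every maximal
   element above a factor in [l1]. Its annihilator is then comaximal with [mprod l1], so
   [c <= mprod l1]. *)
have [[m [pm pm_le mp]]|pmax] :=
  pselect (exists m, [/\ prime_elt m, p <= m & ~~ (m <= p)]).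
  exists \bot; split; [exact: compact_bot|exact: le0x|rewrite join0x].
  apply: (generating_le cgen) => c cc cp.
  have c0 : residual \bot c `|` mprod l1 = \top.
    apply: comaximal_mprod => q; rewrite mem_filter => /andP[pq _].
    apply: comaximal_of_maximal => // m' mm'; apply: contraTN => qm'.
    apply: locally_zero_below_prime cp => //; first exact: maximal_prime.
      exact: le_trans qm'.
    apply: contra (prime_neq1 pm) => m'p.
    rewrite -(mm'.2 m) ?leUx ?lexx ?(le_trans m'p) //.
    by apply: contra mp => /le_trans; apply.
  rewrite -(mulmx1 c) -c0 mulmDr leUx lem_mull andbT mlmulC.
  by rewrite (le_trans (mul_residual _ _)) ?le0x.
(* Otherwise [p] is the only prime above [p], so [mprod l1] is a power of [p], and a bound modulo
   [p * p] iterates to all powers. *)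
have {}pmax m : prime_elt m -> p <= m -> m = p.
  move=> pm pm_le; apply: le_anti; rewrite pm_le andbT; apply: contrapT => /negP mp.
  by apply: pmax; exists m.
have l1E : mprod l1 = mpow p (size l1).
  have : forall y, y \in l1 -> y = p.
    by move=> y; rewrite mem_filter => /andP[py /pl/pmax]; apply.
  elim: l1 {ur0} => [_|y s IH sp]; first exact: mprod_nil.
  rewrite mprod_cons (sp y) ?mem_head //= IH // => z zs.
  by apply: sp; rewrite inE zs orbT.
suff [y [cy yp ypp]] : exists y, [/\ compact_elt y, y <= p & p <= y `|` p * p].
  exists y; split=> //; rewrite l1E; elim: (size l1) => [|n IH].
    by rewrite joinx1 lex1.
  apply: le_trans ypp _; rewrite leUx leUl /=.
  apply: le_trans (lem_mul2l p IH) _.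
  by rewrite mulmDr leU2 // lem_mull.
have [ppp|] := boolP (p <= p * p).
  by exists \bot; split; [exact: compact_bot|exact: le0x|rewrite join0x].
move=> /(generating_witness cgen)[y [cy yp ypp]]; exists y; split=> //.
have [k [pk yE]] := cfac cy.
have [N Nk Np] : exists2 N, N \in k & N <= p.
  by apply: prime_mprod; rewrite // -[mprod k]yE.
have {}Np : N = p by apply: le_anti; rewrite Np pmin //; apply: pk.
have {}yE : y = p * mprod (rem p k) by rewrite yE; apply: mprod_rem; rewrite -Np.
set s := mprod _ in yE.
have ps : p `|` s = \top.
  apply: comaximal_of_maximal => // m /maximal_prime pm /(pmax _ pm) ->.
  by apply: contra ypp => sp; rewrite yE lem_mul2l.
by rewrite -{1}(mulmx1 p) -ps mulmDr joinC -yE.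
Qed.

(** A non-minimal [m] has a compact minimal prime [p] below it and, by the bound on chains, no prime
    strictly between; [m] is then the join of [p] and a compact element. *)
Lemma prime_compact m : prime_elt m -> compact_elt m.
Proof.
move=> pm.
have [[p [pp pm_le mp]]|mmin] :=
  pselect (exists p, [/\ prime_elt p, p <= m & ~~ (m <= p)]); last first.
  apply: minimal_prime_compact => // q pq qm; apply: contrapT => /negP mq.
  by apply: mmin; exists q.
have cp : compact_elt p.
  apply: minimal_prime_compact => // q pq qp.
  exact: prime_chain_length pq pp pm qp pm_le mp.
have [x [cx xm xp]] := generating_witness cgen mp.
have [l [pl xE]] := cfac cx.
have [N Nl Nm] : exists2 N, N \in l & N <= m.
  by apply: prime_mprod; rewrite // -[mprod l]xE.
have pN := pl _ Nl.
have Np : ~~ (N <= p).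
  by apply: contra xp; apply: le_trans; rewrite xE; apply: mprod_le.
have pN_le : p <= N.
  apply: contraNT (prime_neq1 pm) => pN'.
  by rewrite -(Pruefer_primes_comaximal pp pN) // leUx pm_le.
have NE : N = m.
  apply: le_anti; rewrite Nm; apply: contraNT Np => mN.
  exact: (prime_chain_length pp pN pm pN_le Nm mN).
have {}xE : x = m * mprod (rem m l) by rewrite xE; apply: mprod_rem; rewrite -NE.
set y := mprod _ in xE.
(* As [x = m * y] is compact, some compact [a <= m] has [x <= a * y]; so [m * x <= a * x], and
   cancelling [x] leaves its annihilator, which is below [p]. *)
have [|||_ [a [ca am] <-] xay] := @compact_directed _ _ x
    [set w * y | w in [set w | compact_elt w /\ w <= m]] (\bot * y) cx.
- by exists \bot => //; split; [apply: compact_bot|apply: le0x].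
- move=> _ _ [u [cu um] <-] [v [cv vm] <-]; exists ((u `|` v) * y).
    by exists (u `|` v); rewrite //= leUx um; split=> //; apply: compact_join.
  by rewrite mulmDl.
- rewrite {1}xE {1}(generating_bigsup m cgen) mlmulC mlmul_bigsup.
  apply: bigsup_le => _ [w mw <-]; rewrite mlmulC; apply: le_bigsup.
  by exists w.
suff -> : m = p `|` a by apply: compact_join.
apply: le_anti; rewrite leUx pm_le am /= andbT.
have : m * x <= \bot `|` a * x.
  by rewrite join0x {2}xE mulmCA lem_mul2l.
rewrite le_mul_principal //; last exact: LP.
move=> /le_trans; apply; rewrite leU2 //.
have : residual \bot x * x <= p by rewrite (le_trans (mul_residual _ _)) ?le0x.
by rewrite prime_le_mul // (negbTE xp) orbF.
Qed.

End CompactFactorization.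

Lemma Pruefer_POAFL_ZPI : POAFL L -> ZPI_lattice L.
Proof.
move=> [_ pOA].
have cfac x : compact_elt x -> finite_product_of prime_elt x.
  move=> /LP/pOA; exact: sub_finite_product OA_product_of_primes.
by move=> x; apply: (cfac); exact: Pruefer_Cohen (prime_compact cfac) x.
Qed.

End Pruefer.

Theorem theorem4p14 (d : Order.disp_t) (L : multLatticeType d)
    (L_C : C_lattice L) (L_pg : principally_generated L) :
  (ZPI_lattice L <-> Pruefer_lattice L /\ OAFL L) /\
  (Pruefer_lattice L /\ OAFL L <-> Pruefer_lattice L /\ POAFL L).
Proof.
have ZPI_OAFL : ZPI_lattice L -> Pruefer_lattice L /\ OAFL L.
  move=> zpi; split; first exact: ZPI_Pruefer zpi L_pg (C_lattice_top L_C).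
  split=> // x; apply: sub_finite_product (zpi x) => p [p1 pp].
  apply: finite_product1; split=> // a b c _ _ _; exact: pp.
have OAFL_POAFL : Pruefer_lattice L /\ OAFL L -> Pruefer_lattice L /\ POAFL L.
  by move=> [LP [_ oa]]; split=> //; split.
have POAFL_ZPI : Pruefer_lattice L /\ POAFL L -> ZPI_lattice L.
  by move=> [LP]; apply: Pruefer_POAFL_ZPI.
split; split=> //; last by move=> /POAFL_ZPI/ZPI_OAFL.
by move=> /OAFL_POAFL/POAFL_ZPI.
Qed.
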